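(* The function $g$ is a Lyapunov function for the dynamical system $y'(t)=V(y(t))$, that is, $$\langle V(y),\nabla g(y)\rangle=\sum_{n\in\mathcal{X}}V_n(y)\frac{\partial g}{\partial y_n}(y)\le0\qquad\text{for all }y\in\overset{\circ}{\mathcal{P}}(\mathcal{X}),$$ and, for $y\in\overset{\circ}{\mathcal{P}}(\mathcal{X})$, the following assertions are equivalent: (a) $\langle V(y),\nabla g(y)\rangle=0$; (b) the coordinates $\frac{\partial g}{\partial y_n}(y)$, $n\in\mathcal{X}$, of $\nabla g(y)$ are all equal; (c) $y$ is an equilibrium point, that is, $V(y)=0$.
   Context: Fix integers $K\ge1$, $C\ge1$, positive integers $A_1,\dots,A_K$ and rates $\lambda_k>0$, $\gamma_k>0$, $\mu_k\ge0$ for $1\le k\le K$. Let $f_k$ be the $k$th unit vector of $\mathbb{R}^K$, let $$\mathcal{X}=\{n=(n_k)\in\mathbb{N}^K: A_1n_1+\cdots+A_Kn_K\le C\}\quad(\mathbb{N}=\{0,1,2,\dots\}),$$ let $\mathcal{P}(\mathcal{X})$ be the set of probability distributions $y=(y_n)_{n\in\mathcal{X}}$ on $\mathcal{X}$ and $\overset{\circ}{\mathcal{P}}(\mathcal{X})$ its interior, i.e. the set of those $y\in\mathcal{P}(\mathcal{X})$ with $y_n>0$ for all $n\in\mathcal{X}$. Write $\langle\mathbb{I}_k,y\rangle=\sum_{m\in\mathcal{X}}m_ky_m$ and $n!=\prod_{k=1}^Kn_k!$. The vector field $V(y)=(V_n(y),\,n\in\mathcal{X})$ is $$V_n(y)=\sum_{k=1}^{K}(\lambda_k+\gamma_k\langle\mathbb{I}_k,y\rangle)\left(y_{n-f_k}\mathbf{1}_{\{n_k\ge1\}}-y_n\mathbf{1}_{\{n+f_k\in\mathcal{X}\}}\right)+\sum_{k=1}^{K}(\gamma_k+\mu_k)\left((n_k+1)y_{n+f_k}\mathbf{1}_{\{n+f_k\in\mathcal{X}\}}-n_ky_n\right),$$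 where terms multiplied by a zero indicator are $0$. The function $g$ is $$g(y)=\sum_{n\in\mathcal{X}}y_n\log(n!\,y_n)-\sum_{k=1}^{K}\int_0^{\langle\mathbb{I}_k,y\rangle}\log\frac{\lambda_k+\gamma_kx}{\mu_k+\gamma_k}\,dx,$$ and the partial derivatives $\partial g/\partial y_n$ are those of this formula viewed as a function of the independent variables $(y_n)_{n\in\mathcal{X}}\in(0,\infty)^{\mathcal{X}}$. *)

(* Defs.v *)
(* MathComp-Analysis world: the real numbers are an arbitrary R : realType. *)
From HB Require Import structures.
From mathcomp Require Import all_boot all_order all_algebra.
From mathcomp Require Import all_classical all_reals all_analysis.
Set Implicit Arguments.
Unset Strict Implicit.
Unset Printing Implicit Defensive.
Import Order.TTheory GRing.Theory Num.Theory numFieldNormedType.Exports.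
Local Open Scope classical_set_scope.
Local Open Scope ring_scope.

Section StateSpace.
Context (K C : nat) (A : 'I_K -> nat).

Definition feasible (m : 'I_K -> nat) : bool :=
  (\sum_(k < K) A k * m k <= C)%N.

(* The finite type X.  When all the A k are positive, a feasible m has all its
   coordinates at most C, so bounding the coordinates by C loses nothing
   (state_of_feasible). *)
Definition state : Type :=
  {n : {ffun 'I_K -> 'I_C.+1} | feasible (fun k => n k : nat)}.

HB.instance Definition _ := Finite.on state.

Definition occ (n : state) (k : 'I_K) : nat := val n k.

Lemma state_of_feasible (hA : forall k, (0 < A k)%N) (m : 'I_K -> nat) :
  feasible m -> exists n : state, occ n =1 m.
Proof.
move=> fm; have mC k : (m k < C.+1)%N.
  rewrite ltnS (leq_trans _ fm) // (bigD1 k) //=.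
  by rewrite (leq_trans (leq_pmull _ (hA k))) // leq_addr.
have fm' : feasible (fun k => [ffun k => Ordinal (mC k)] k : nat).
  by rewrite /feasible; under eq_bigr do rewrite ffunE.
by exists (exist _ [ffun k => Ordinal (mC k)] fm') => k; rewrite /occ /= ffunE.
Qed.

Lemma occ_inj (n n' : state) : occ n =1 occ n' -> n = n'.
Proof. by move=> e; apply/val_inj/ffunP => k; apply/val_inj/e. Qed.

(* n + f_k and n - f_k; the latter is only used when n_k >= 1. *)
Definition addf (m : 'I_K -> nat) (k : 'I_K) : 'I_K -> nat :=
  fun j => (m j + (j == k))%N.
Definition subf (m : 'I_K -> nat) (k : 'I_K) : 'I_K -> nat :=
  fun j => (m j - (j == k))%N.

End StateSpace.

Section Dynamics.
Context (R : realType) (K C : nat) (A : 'I_K -> nat).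
Context (lambda gamma mu : 'I_K -> R).
Local Notation X := (state C A).
Implicit Type y : X -> R.

Definition is_distribution y : Prop :=
  (forall n, 0 <= y n) /\ \sum_(n : X) y n = 1.

Definition interior_distribution y : Prop :=
  is_distribution y /\ forall n, 0 < y n.

(* y_m for an arbitrary m in N^K, extended by 0 outside X. *)
Definition coordinate y (m : 'I_K -> nat) : R :=
  if [pick n : X | [forall k, occ n k == m k]] is Some n then y n else 0.

Definition mean y (k : 'I_K) : R := \sum_(m : X) (occ m k)%:R * y m.

Definition V y (n : X) : R :=
  \sum_(k < K) (lambda k + gamma k * mean y k) *
    (coordinate y (subf (occ n) k) * (1 <= occ n k)%N%:R
     - y n * (feasible C A (addf (occ n) k))%:R)
  + \sum_(k < K) (gamma k + mu k) *
    ((occ n k).+1%:R * coordinate y (addf (occ n) k)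
       * (feasible C A (addf (occ n) k))%:R
     - (occ n k)%:R * y n).

Definition state_fact (n : X) : nat := (\prod_(k < K) (occ n k)`!)%N.

(* Only evaluated where all y n > 0, so that mean y k >= 0 and the integral over
   the interval [0, mean y k] is the usual oriented one. *)
Definition g y : R :=
  \sum_(n : X) y n * ln ((state_fact n)%:R * y n)
  - \sum_(k < K) \int[lebesgue_measure]_(x in `[0, mean y k])
      ln ((lambda k + gamma k * x) / (mu k + gamma k)).

Definition partial (F : (X -> R) -> R) (n : X) y : R :=
  derive1 (fun t : R => F [eta y with n |-> t]) (y n).

End Dynamics.

(* Main.v *)
Require Import Defs.
From HB Require Import structures.
From mathcomp Require Import all_boot all_order all_algebra.
From mathcomp Require Import all_classical all_reals all_analysis.
From mathcomp Require Import ring.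
Set Implicit Arguments.
Unset Strict Implicit.
Unset Printing Implicit Defensive.
Import Order.TTheory GRing.Theory Num.Theory numFieldNormedType.Exports.
Local Open Scope ring_scope.

(** Freeze the means <I_k, y>.  Then V(y) is the drift at y of a birth-death
    process on X in which the step n -> n + f_k occurs at the constant rate
    a_k = lambda_k + gamma_k <I_k, y> and is undone at the rate b_k (n_k + 1),
    where b_k = mu_k + gamma_k.  So V_n(y) is the net flow into n
    ([V_flux]), the flow along the step n -> n + f_k being u - v with
      u = a_k y_n   and   v = b_k (n_k + 1) y_(n + f_k).

    By the fundamental theorem of calculus ([partial_g]),
      dg/dy_n = 1 + log (n! y_n) - sum_k n_k log (a_k / b_k),
    with the same a_k, b_k: the derivative of the integral in g is exactly what
    reinstates the dependence of the rates on y.  Its increment along the step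
    n -> n + f_k is therefore log v - log u ([partial_g_step]).

    Summation by parts ([sum_V_mul]) turns <V, grad g> into the sum over all
    steps of (u - v) (log v - log u), and each term is nonpositive because log is
    increasing.

    (a) => (b): when the sum vanishes every term does, hence grad g has equal
    coordinates at the two ends of each step; all states are joined to the empty
    state by steps ([eq_of_step]).
    (b) => (c): if grad g is constant, u = v on every step as log is injective,
    so that all flows, and with them V, vanish (detailed balance).
    (c) => (a) is immediate. *)

(* The shift m + f_k, as opposed to the addition of fractions. *)
Local Notation addf := Defs.addf.

(** * Steps between states *)

Section Steps.
Context (K C : nat) (A : 'I_K -> nat).
Local Notation X := (state C A).

Definition step (k : 'I_K) (n m : X) : bool :=
  [forall j, occ m j == addf (occ n) k j].

Lemma occ_step k (n m : X) : step k n m -> occ m k = (occ n k).+1.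
Proof. by move=> /forallP/(_ k)/eqP ->; rewrite /addf eqxx addn1. Qed.

Lemma occ_step_neq k (n m : X) j :
  step k n m -> j != k -> occ m j = occ n j.
Proof.
by move=> /forallP/(_ j)/eqP -> /negbTE jk; rewrite /addf jk addn0.
Qed.

(** The condition on m_k excludes the case where the truncated subtraction in
    [subf] leaves m unchanged. *)
Lemma step_subf k (n m : X) :
  step k n m = (1 <= occ m k)%N && [forall j, occ n j == subf (occ m) k j].
Proof.
apply/idP/andP => [nm|[mk /forallP nm]].
  split; first by rewrite (occ_step nm).
  apply/forallP => j; rewrite /subf; have [->|jk] := eqVneq j k.
    by rewrite (occ_step nm) subn1.
  by rewrite subn0 (occ_step_neq nm jk).
apply/forallP => j; rewrite /addf (eqP (nm j)) /subf.
by case: (eqVneq j k) => [->|_] /=; rewrite ?subn0 ?addn0 // subnK.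
Qed.

Lemma feasible_occ (n : X) : feasible C A (occ n).
Proof. exact: (valP n). Qed.

Lemma feasible_subf k (n : X) : feasible C A (subf (occ n) k).
Proof.
apply: leq_trans (feasible_occ n); apply: leq_sum => j _.
by rewrite leq_mul2l leq_subr orbT.
Qed.

Hypothesis A_gt0 : forall k, (0 < A k)%N.

Lemma exists_pred k (m : X) : (1 <= occ m k)%N -> exists n, step k n m.
Proof.
move=> mk; have [n nE] := state_of_feasible A_gt0 (feasible_subf k m).
by exists n; rewrite step_subf mk; apply/forallP => j; rewrite nE.
Qed.

(** The graph of steps is connected: removing customers one at a time leads from
    any state to the empty one without leaving X. *)
Lemma eq_of_step (T : Type) (f : X -> T) :
  (forall k n m, step k n m -> f n = f m) -> forall n n', f n = f n'.
Proof.
move=> f_step.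
have empty s n n' :
    (\sum_k occ n k)%N = s -> (forall k, occ n' k = 0)%N -> f n = f n'.
  elim: s n => [|s IHs] n ns n'0.
    congr f; apply: occ_inj => k; rewrite n'0.
    by move/eqP: ns; rewrite sum_nat_eq0 => /forallP/(_ k)/eqP.
  have [k nk] : exists k, (1 <= occ n k)%N.
    apply/existsP; apply: contraT => /existsPn n0; move: ns.
    by rewrite big1 // => k _; apply/eqP; rewrite -leqn0 leqNgt; exact: n0.
  have [m mn] := exists_pred nk.
  rewrite -(f_step _ _ _ mn); apply: IHs => //.
  move: ns; rewrite (bigD1 k) //= (occ_step mn) addSn => -[<-].
  rewrite (bigD1 k) //=; congr addn; apply: eq_bigr => j jk.
  by rewrite (occ_step_neq mn jk).
have [|z z0] := @state_of_feasible K C A A_gt0 (fun=> 0%N).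
  by rewrite /feasible big1 // => k _; rewrite muln0.
by move=> n n'; rewrite (empty _ n z erefl z0) (empty _ n' z erefl z0).
Qed.

Context (R : realType).

(** By [occ_inj] the sum has at most one term.  Rewriting the extension by zero
    and the indicators of V as sums over steps makes the incoming and outgoing
    flows range over the same set of pairs of states. *)
Lemma coordinateE (y : X -> R) (q : 'I_K -> nat) :
  coordinate y q = \sum_(n : X | [forall j, occ n j == q j]) y n.
Proof.
rewrite /coordinate; case: pickP => [n /forallP nq|none].
  rewrite (big_pred1 n) // => m; apply/forallP/eqP => [mq|-> //].
  by apply: occ_inj => j; rewrite (eqP (mq j)) (eqP (nq j)).
by rewrite big_pred0.
Qed.

Lemma feasibleE (q : 'I_K -> nat) :
  (feasible C A q)%:R = \sum_(n : X | [forall j, occ n j == q j]) 1 :> R.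
Proof.
have [fq|nfq] := boolP (feasible C A q).
  have [n nq] := state_of_feasible A_gt0 fq.
  rewrite (big_pred1 n) // => m; apply/forallP/eqP => [mq|-> j].
    by apply: occ_inj => j; rewrite (eqP (mq j)) nq.
  by rewrite nq.
rewrite big_pred0 // => n; apply/negbTE; apply: contra nfq => /forallP nq.
have := feasible_occ n; rewrite /feasible.
by under eq_bigr do rewrite (eqP (nq _)).
Qed.

Lemma sum_step_in (F : X -> R) k (m : X) :
  \sum_(n | step k n m) F n =
  coordinate F (subf (occ m) k) * (1 <= occ m k)%N%:R.
Proof.
rewrite coordinateE (eq_bigl _ _ (fun n => step_subf k n m)).
by case: (1 <= occ m k)%N => /=; [rewrite mulr1 | rewrite mulr0 big_pred0].
Qed.

Lemma sum_step_in1 k (m : X) :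
  \sum_(n | step k n m) 1 = (1 <= occ m k)%N%:R :> R.
Proof.
rewrite (eq_bigl _ _ (fun n => step_subf k n m)).
case: (1 <= occ m k)%N => /=; last by rewrite big_pred0.
by rewrite -feasibleE feasible_subf.
Qed.

Lemma sum_step_out (F : X -> R) k (n : X) :
  \sum_(m | step k n m) F m =
  coordinate F (addf (occ n) k) * (feasible C A (addf (occ n) k))%:R.
Proof.
rewrite coordinateE mulr_suml; apply: eq_bigr => m /forallP nm.
have := feasible_occ m; rewrite /feasible.
by under eq_bigr do rewrite (eqP (nm _)); move=> ->; rewrite mulr1.
Qed.

Lemma sum_step_out1 k (n : X) :
  \sum_(m | step k n m) 1 = (feasible C A (addf (occ n) k))%:R :> R.
Proof. by rewrite feasibleE. Qed.

End Steps.

(** * The vector field as a net flow *)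

Section Flux.
Context (R : realType) (K C : nat) (A : 'I_K -> nat).
Context (lambda gamma mu : 'I_K -> R).
Hypothesis A_gt0 : forall k, (0 < A k)%N.
Local Notation X := (state C A).
Local Notation V := (V lambda gamma mu).
Implicit Type y : X -> R.

Definition arrivals y (k : 'I_K) (n : X) : R :=
  (lambda k + gamma k * mean y k) * y n.
Definition departures y (k : 'I_K) (m : X) : R :=
  (mu k + gamma k) * ((occ m k)%:R * y m).
Definition flux y k n m := arrivals y k n - departures y k m.

Lemma V_flux y (n : X) :
  V y n = \sum_(k < K) (\sum_(m | step k m n) flux y k m n
                        - \sum_(m | step k n m) flux y k n m).
Proof.
rewrite /V -big_split; apply: eq_bigr => k _ /=.
have -> : \sum_(m | step k m n) flux y k m n =
    (lambda k + gamma k * mean y k) * (\sum_(m | step k m n) y m)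
    - departures y k n * \sum_(m | step k m n) 1.
  rewrite [X in _ = X - _]mulr_sumr [X in _ = _ - X]mulr_sumr -sumrB.
  by apply: eq_bigr => m _; rewrite mulr1.
have -> : \sum_(m | step k n m) flux y k n m =
    arrivals y k n * (\sum_(m | step k n m) 1)
    - (mu k + gamma k) * ((occ n k).+1%:R * (\sum_(m | step k n m) y m)).
  rewrite mulr_sumr mulr_sumr mulr_sumr -sumrB; apply: eq_bigr => m nm.
  by rewrite mulr1 /flux /departures (occ_step nm).
rewrite sum_step_in1 // sum_step_in sum_step_out1 // sum_step_out.
rewrite /departures /arrivals.
by case: (occ n k) => [|s] /=; ring.
Qed.

(** Summation by parts: the flow along n -> m is counted positively at m and
    negatively at n. *)
Lemma sum_V_mul y (phi : X -> R) :
  \sum_(n : X) V y n * phi n =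
  \sum_(k < K) \sum_(n : X) \sum_(m | step k n m)
    flux y k n m * (phi m - phi n).
Proof.
under eq_bigr do rewrite V_flux mulr_suml.
rewrite exchange_big; apply: eq_bigr => k _ /=.
under eq_bigr do rewrite mulrBl.
rewrite sumrB.
under [X in X - _ = _]eq_bigr do rewrite mulr_suml.
rewrite (exchange_big_dep predT) //= -sumrB; apply: eq_bigr => n _.
by rewrite mulr_suml -sumrB; apply: eq_bigr => m _; rewrite mulrBr.
Qed.

End Flux.

(** * The gradient of g *)

Section Gradient.
Context (R : realType).

Lemma is_derive_ln_scale (c t : R) : 0 < c -> 0 < t ->
  is_derive t 1 (fun x : R => x * ln (c * x)) (1 + ln (c * t)).
Proof.
move=> c0 t0.
have ct0 : 0 < c * t by rewrite mulr_gt0.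
have dln := is_derive1_ln ct0.
have dlin : is_derive t 1 (fun x : R => c * x) c.
  by apply: (is_derive_eq (is_deriveZ c (is_derive_id t 1))); exact: mulr1.
have dcomp := is_derive1_comp dln dlin.
have := is_deriveM (is_derive_id t 1) dcomp.
move/is_derive_eq; apply.
by rewrite /GRing.scale /=; field; rewrite !gt_eqF.
Qed.

Lemma is_derive_integral_ln (l c b m : R) : 0 < l -> 0 < c -> 0 < b -> 0 < m ->
  is_derive m 1
    (fun u : R => \int[lebesgue_measure]_(x in `[0, u]) ln ((l + c * x) / b))
    (ln ((l + c * m) / b)).
Proof.
move=> l0 c0 b0 m0; pose f x : R := ln ((l + c * x) / b).
have cf x : 0 <= x -> {for x, continuous f}.
  move=> x0.
  have q0 : 0 < (l + c * x) / b.
    by rewrite divr_gt0 // ltr_wpDr // mulr_ge0 // ltW.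
  apply: (@continuous_comp _ _ _ (fun x => (l + c * x) / b) (@ln R)).
    apply: cvgMl; apply: cvgD; [exact: cvg_cst|apply: cvgMr; exact: cvg_id].
  exact: continuous_ln.
(* The integrand has to be integrable up to some bound beyond m. *)
have m1 : m < m + 1 by rewrite ltrDl.
have [|der val] := @continuous_FTC1_closed R f 0 m (m + 1) m1 _ m0 (cf _ (ltW m0)).
  apply: continuous_compact_integrable; first exact: segment_compact.
  apply: continuous_in_subspaceT => x; rewrite inE /= in_itv /= => /andP[x0 _].
  exact: cf.
exact: (DeriveDef der (etrans (esym (derive1E _ _)) val)).
Qed.

Context (K C : nat) (A : 'I_K -> nat).
Context (lambda gamma mu : 'I_K -> R).
Hypothesis lambda_gt0 : forall k, 0 < lambda k.
Hypothesis gamma_gt0 : forall k, 0 < gamma k.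
Hypothesis mu_ge0 : forall k, 0 <= mu k.
Local Notation X := (state C A).
Implicit Type y : X -> R.

Lemma mean_with y (n : X) (t : R) k :
  mean [eta y with n |-> t] k = mean y k + (occ n k)%:R * (t - y n).
Proof.
rewrite /mean (bigD1 n) //= eqxx [in RHS](bigD1 n) //= mulrBr.
rewrite (eq_bigr (fun m => (occ m k)%:R * y m)).
  by ring.
by move=> m /negbTE mn; rewrite mn.
Qed.

Lemma mean_ge0 y k : (forall n, 0 < y n) -> 0 <= mean y k.
Proof. by move=> y0; apply: sumr_ge0 => m _; rewrite mulr_ge0 // ltW. Qed.

Lemma mean_gt0 y (n : X) k :
  (forall n, 0 < y n) -> (0 < occ n k)%N -> 0 < mean y k.
Proof.
move=> y0 nk; rewrite /mean (bigD1 n) //= ltr_pwDl //.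
  by rewrite mulr_gt0 // ltr0n.
by apply: sumr_ge0 => m _; rewrite mulr_ge0 // ltW.
Qed.

Lemma state_fact_gt0 (n : X) : 0 < (state_fact n)%:R :> R.
Proof. by rewrite ltr0n; apply: prodn_gt0 => k; exact: fact_gt0. Qed.

(** Only the n-th term of the entropy depends on y_n, while <I_k, y> is affine in
    y_n with slope n_k, which yields the factor n_k by the chain rule. *)
Lemma partial_g y (n : X) : (forall n, 0 < y n) ->
  partial (g lambda gamma mu) n y =
  1 + ln ((state_fact n)%:R * y n)
  - \sum_(k < K) (occ n k)%:R
      * ln ((lambda k + gamma k * mean y k) / (mu k + gamma k)).
Proof.
move=> y0; rewrite /partial.
pose f k (x : R) := ln ((lambda k + gamma k * x) / (mu k + gamma k)).
pose I k (u : R) := \int[lebesgue_measure]_(x in `[0, u]) f k x.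
pose rest := \sum_(m | m != n) y m * ln ((state_fact m)%:R * y m).
have -> : (fun t : R => g lambda gamma mu [eta y with n |-> t]) =
    (fun t : R => t * ln ((state_fact n)%:R * t)) + cst rest
    - \sum_(k < K) (fun t => I k (mean y k + (occ n k)%:R * (t - y n))).
  apply/funext => t; rewrite /g !fctE fct_sumE; congr (_ - _).
    rewrite (bigD1 n) //= eqxx; congr (_ + _).
    by apply: eq_bigr => m /negbTE mn; rewrite mn.
  by apply: eq_bigr => k _; rewrite mean_with.
have dI k : is_derive (y n) 1
    (fun t => I k (mean y k + (occ n k)%:R * (t - y n)))
    ((occ n k)%:R * f k (mean y k)).
  (* If n_k = 0 the function is constant; this case is separate because
     <I_k, y> may then be 0, an endpoint at which the integral need not be
     differentiable. *)
  have [nk0|nk0] := posnP (occ n k).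
    under eq_fun do rewrite nk0 mul0r addr0.
    by rewrite nk0 mul0r; exact: is_derive_cst.
  pose a (t : R) := mean y k + (occ n k)%:R * (t - y n).
  have an : a (y n) = mean y k by rewrite /a subrr mulr0 addr0.
  have da : is_derive (y n) 1 a (occ n k)%:R.
    rewrite /a; apply: is_derive_eq.
    by rewrite /GRing.scale /=; ring.
  have dI : is_derive (a (y n)) 1 (I k) (f k (mean y k)).
    rewrite an; apply: is_derive_integral_ln => //.
      by rewrite ltr_wpDl.
    exact: (mean_gt0 y0 nk0).
  have := is_derive1_comp dI da.
  by move/is_derive_eq; apply; rewrite [LHS]mulrC.
have d1 := is_derive_ln_scale (state_fact_gt0 n) (y0 n).
have d2 : is_derive (y n) (1 : R) (cst rest : R -> R) 0 by exact: is_derive_cst.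
have := is_deriveB (is_deriveD d1 d2) (is_derive_sum dI).
by rewrite derive1E addr0; case.
Qed.

Lemma arrivals_gt0 y k (n : X) :
  (forall n, 0 < y n) -> 0 < arrivals lambda gamma y k n.
Proof.
move=> y0; rewrite mulr_gt0 // ltr_pwDl //.
by rewrite mulr_ge0 ?mean_ge0 // ltW.
Qed.

Lemma departures_gt0 y k (n m : X) :
  (forall n, 0 < y n) -> step k n m -> 0 < departures gamma mu y k m.
Proof.
by move=> y0 nm; rewrite !mulr_gt0 ?ltr_wpDl // (occ_step nm) ltr0n.
Qed.

Lemma state_fact_step k (n m : X) :
  step k n m -> state_fact m = (occ m k * state_fact n)%N.
Proof.
move=> nm; rewrite /state_fact (bigD1 k) //= [in RHS](bigD1 k) //=.
rewrite (occ_step nm) factS -!mulnA; congr (_ * (_ * _))%N.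
by apply: eq_bigr => j jk; rewrite (occ_step_neq nm jk).
Qed.

(** With m = n + f_k the factorials contribute log (n_k + 1) and the linear term
    - log (a_k / b_k), which recombine into the logarithms of the two opposite
    rates along the step. *)
Lemma partial_g_step y k (n m : X) : (forall n, 0 < y n) -> step k n m ->
  partial (g lambda gamma mu) m y - partial (g lambda gamma mu) n y =
  ln (departures gamma mu y k m) - ln (arrivals lambda gamma y k n).
Proof.
move=> y0 nm; rewrite !partial_g // (bigD1 k) //= [in X in _ - X](bigD1 k) //=.
under eq_bigr => j jk do rewrite (occ_step_neq nm jk).
have a0 : 0 < lambda k + gamma k * mean y k.
  by rewrite ltr_pwDl // mulr_ge0 ?mean_ge0 // ltW.
have b0 : 0 < mu k + gamma k by rewrite ltr_wpDl.
have m0 : 0 < (occ m k)%:R :> R by rewrite (occ_step nm) ltr0n.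
rewrite /departures /arrivals (state_fact_step nm) natrM -mulrA.
rewrite ln_div ?posrE // !lnM ?posrE ?mulr_gt0 ?state_fact_gt0 //.
rewrite (occ_step nm) -natr1; ring.
Qed.

End Gradient.

(** * Monotonicity of the logarithm *)

Section LogMonotone.
Context (R : realType).
Implicit Types u v : R.

Lemma mul_subr_ln_le0 u v : 0 < u -> 0 < v -> (u - v) * (ln v - ln u) <= 0.
Proof.
move=> u0 v0; have [uv|/ltW vu] := leP u v.
  by rewrite mulr_le0_ge0 // ?subr_le0 // subr_ge0 ler_ln ?posrE.
by rewrite mulr_ge0_le0 // ?subr_ge0 // subr_le0 ler_ln ?posrE.
Qed.

Lemma ln_eq_of_mul0 u v : (u - v) * (ln v - ln u) = 0 -> ln u = ln v.
Proof.
by move=> /eqP; rewrite mulf_eq0 !subr_eq0 => /orP[/eqP -> | /eqP ->].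
Qed.

End LogMonotone.

(** * The Lyapunov property *)

Theorem proposition4 (R : realType) (K C : nat) (A : 'I_K -> nat)
    (lambda gamma mu : 'I_K -> R)
    (hK : (1 <= K)%N) (hC : (1 <= C)%N) (hA : forall k, (0 < A k)%N)
    (hlambda : forall k, 0 < lambda k) (hgamma : forall k, 0 < gamma k)
    (hmu : forall k, 0 <= mu k) :
  (forall y : state C A -> R, interior_distribution y ->
     \sum_(n : state C A)
       V lambda gamma mu y n * partial (g lambda gamma mu) n y <= 0) /\
  (forall y : state C A -> R, interior_distribution y ->
     [<-> (* a *)
          \sum_(n : state C A)
            V lambda gamma mu y n * partial (g lambda gamma mu) n y = 0;
          (* b *)
          forall n n' : state C A,
            partial (g lambda gamma mu) n y = partial (g lambda gamma mu) n' y;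
          (* c *)
          forall n : state C A, V lambda gamma mu y n = 0]).
Proof.
pose dg (y : state C A -> R) n := partial (g lambda gamma mu) n y.
have term_le0 y k n m : (forall n, 0 < y n) -> step k n m ->
    flux lambda gamma mu y k n m * (dg y m - dg y n) <= 0.
  move=> y0 nm; rewrite /dg (partial_g_step hlambda hgamma hmu y0 nm).
  apply: mul_subr_ln_le0; first exact: arrivals_gt0.
  exact: departures_gt0 nm.
split=> y [_ y0].
  rewrite sum_V_mul //; apply: sumr_le0 => k _; apply: sumr_le0 => n _.
  by apply: sumr_le0 => m; exact: term_le0.
tfae=> [|dg_const n|V0].
- rewrite (sum_V_mul lambda gamma mu hA) => sum0; apply: (eq_of_step hA) => k n m nm.
  have nonneg k' n' m' : step k' n' m' ->
      0 <= - (flux lambda gamma mu y k' n' m' * (dg y m' - dg y n')).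
    by move=> ?; rewrite oppr_ge0 term_le0.
  (* A vanishing sum of nonpositive terms has only zero terms. *)
  move/eqP: sum0; rewrite -oppr_eq0 -sumrN.
  under eq_bigr do (rewrite -sumrN; under eq_bigr do rewrite -sumrN).
  rewrite psumr_eq0 => [/allP/(_ k (mem_index_enum _))|k' _]; last first.
    by apply: sumr_ge0 => n' _; apply: sumr_ge0 => m'; exact: nonneg.
  rewrite psumr_eq0 => [/allP/(_ n (mem_index_enum _))|n' _]; last first.
    by apply: sumr_ge0 => m'; exact: nonneg.
  rewrite psumr_eq0 => [/allP/(_ m (mem_index_enum _))|m']; last exact: nonneg.
  rewrite nm oppr_eq0 /= (partial_g_step hlambda hgamma hmu y0 nm) => /eqP/ln_eq_of_mul0 e.
  apply/eqP; rewrite eq_sym -subr_eq0 (partial_g_step hlambda hgamma hmu y0 nm).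
  by rewrite e subrr.
- have flux0 k n' m : step k n' m -> flux lambda gamma mu y k n' m = 0.
    move=> nm; have := partial_g_step hlambda hgamma hmu y0 nm.
    rewrite (dg_const m n') subrr => /esym/eqP; rewrite subr_eq0 => /eqP e.
    apply/eqP; rewrite subr_eq0; apply/eqP/esym/ln_inj => //; rewrite posrE.
      exact: departures_gt0 nm.
    exact: arrivals_gt0.
  rewrite V_flux // big1 // => k _.
  by rewrite !big1 ?subrr // => m; exact: flux0.
- by apply: big1 => n _; rewrite V0 mul0r.
Qed.
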